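(* Let $t$ be a positive integer and $g=2t+2$. Let $\omega\in\mathcal{DD}_{(2t+2)}$, let $\mathbf{v}=(v_1,\dots,v_t)\in\mathbb{Z}^t$ be its $V_{g,t}$-coding, and set $r_i=v_i-t-1$ for $1\leq i\leq t$. Then $$\lvert\omega\rvert=\frac{1}{g}\sum_{i=1}^{t}r_i^2-\frac{(g/2-1)(g-1)}{12}.$$ Moreover, setting $\alpha_i(\omega)=\#\{u\in\omega: h_u=g-i,\ \varepsilon_u=1\}$ for $1\leq i\leq g-1$, for every field $F$ and every function $\tau:\mathbb{Z}\to F^{\times}$, $$\prod_{s\in\omega}\frac{\tau(h_s-\varepsilon_s g)}{\tau(h_s)}=\prod_{i=1}^{g-1}\left(\frac{\tau(-i)}{\tau(i)}\right)^{\alpha_i(\omega)}\prod_{i=1}^{t}\frac{\tau(r_i)}{\tau(i)}\prod_{1\leq i<j\leq t}\frac{\tau(r_i-r_j)}{\tau(j-i)}\,\frac{\tau(r_i+r_j)}{\tau(g-i-j)}.$$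
   Context: A partition $\lambda=(\lambda_1\geq\lambda_2\geq\dots)$ (with $\lambda_i=0$ for $i>\ell(\lambda)$) has Ferrers diagram consisting of boxes $(i,j)$ with $1\leq j\leq\lambda_i$; products/counts ''over $s\in\omega$'' range over these boxes. $\lambda'$ is the conjugate partition, $|\lambda|=\sum\lambda_i$. The hook length of a box $s=(i,j)$ is $h_s=\lambda_i-j+\lambda'_j-i+1$. The Durfee size is $d_\lambda=\max\{s:\lambda_s\geq s\}$. For a box $s=(i,j)$, $\varepsilon_s=-1$ if $i>j$ and $\varepsilon_s=1$ otherwise. A partition is a $k$-core if none of its hook lengths is divisible by $k$. $\mathcal{DD}$ is the set of partitions $\lambda$ with $\lambda_i=\lambda'_i+1$ for all $1\leq i\leq d_\lambda$; $\mathcal{DD}_{(k)}$ is the set of its elements that are $k$-cores. $V_{g,t}$-coding: for a partition $\lambda$ and each residue $r\in\{0,\dots,g-1\}$, let $\beta_r=g+\max\{\lambda_j-j: j\geq 1,\ \lambda_j-j\equiv r \pmod g\}$ ($j$ ranging over all positive integers, $\lambda_j=0$ for $j>\ell(\lambda)$). These are distinct; list them decreasingly $\beta_{\sigma(1)}>\dots>\beta_{\sigma(g)}$. The $V_{g,t}$-coding of $\lambda$ is $(v_1,\dots,v_t)=(\beta_{\sigma(1)},\dots,\beta_{\sigma(t)})$. *)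

(* Defs.v *)
From mathcomp Require Import all_boot all_order all_algebra.
Set Implicit Arguments. Unset Strict Implicit. Unset Printing Implicit Defensive.
Import Order.TTheory GRing.Theory Num.Theory.

(* A partition is a weakly decreasing list of positive naturals
   la = [:: la_1; la_2; ...]; parts are 1-indexed. *)
Definition is_partition (la : seq nat) : bool :=
  sorted geq la && all (fun x => 0 < x) la.

(* la_i for i >= 1 (0 beyond the length). *)
Definition part (la : seq nat) (i : nat) : nat := nth 0 la i.-1.

Definition conjpart (la : seq nat) (j : nat) : nat := count (fun x => j <= x) la.

Definition psize (la : seq nat) : nat := sumn la.

Definition boxes (la : seq nat) : seq (nat * nat) :=
  flatten [seq [seq (i, j) | j <- iota 1 (part la i)] | i <- iota 1 (size la)].

Definition hook (la : seq nat) (s : nat * nat) : int :=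
  ((part la s.1)%:Z - (s.2)%:Z + (conjpart la s.2)%:Z - (s.1)%:Z + 1)%R.

Definition eps (s : nat * nat) : int := if s.2 < s.1 then (-1)%R else 1%R.

(* Durfee size: max {s : la_s >= s} (0 if no such s; s ranges up to l(la)
   since la_s = 0 < s beyond the length). *)
Definition durfee (la : seq nat) : nat :=
  \max_(s < (size la).+1 | s <= part la s) s.

Definition is_DD (la : seq nat) : Prop :=
  forall i, 1 <= i <= durfee la -> part la i = (conjpart la i).+1.

Definition is_core (k : nat) (la : seq nat) : bool :=
  all (fun s => hook la s \notin dvdz (k%:Z)) (boxes la).

(* the values la_j - j, j >= 1, in residue class r mod g.  Only j <= l(la)+g
   need to be considered: for j > l(la)+g, la_j - j = -j and j - g (> l(la))
   has the same residue with a larger value. *)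
Definition resvals (g : nat) (la : seq nat) (r : nat) : seq int :=
  [seq ((part la j)%:Z - j%:Z)%R | j <- iota 1 (size la + g)
     & ((part la j)%:Z - j%:Z - r%:Z)%R \in dvdz (g%:Z)].

Definition seqmax (s : seq int) : int := foldr Num.max (head 0%R s) s.

Definition beta (g : nat) (la : seq nat) (r : nat) : int :=
  (g%:Z + seqmax (resvals g la r))%R.

Definition Vcoding (g t : nat) (la : seq nat) : seq int :=
  take t (sort (fun x y : int => (y <= x)%R) [seq beta g la r | r <- iota 0 g]).

Definition alpha (g : nat) (la : seq nat) (i : nat) : nat :=
  count (fun u => (hook la u == g%:Z - i%:Z)%R && (eps u == 1%R)) (boxes la).

(* Main.v *)
Require Import Defs.
From mathcomp Require Import all_boot all_order all_algebra.
From mathcomp Require Import zify ring lra.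
Import Order.TTheory GRing.Theory Num.Theory.

Set Implicit Arguments.
Unset Strict Implicit.
Unset Printing Implicit Defensive.

(** Let [S = {la_i - i}].  The boxes of [la] correspond to the pairs
    [x \in S], [y \notin S], [y < x], with hook length [x - y].  The condition
    [DD] says that [x \in S] iff [- x \notin S] for [x != 0] and that
    [0 \notin S]; under it a box has [eps = 1] iff [x + y >= 0].  Being a
    [g]-core says that [S - g] is contained in [S], and the numbers [beta] form
    the set [B = (S + g) \ S = {0, t+1, t+1 + r_i, t+1 - r_i}].

    After the sign factors [tau (-i) / tau i] are split off, the product formula
    is an identity of multisets of positive integers, proved by counting the
    occurrences of each [m > 0].  If [N m] is the number of [x \in S] with
    [x - m \notin S], then [N (m+g) + N (m-g) - 2 N m] is the number of pairs
    in [B] with difference [m], because [S - g] is contained in [S].  The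
    reflection [x |-> m - x] turns [N] into the counts with [eps = 1] and
    [eps = -1].  The terms that do not involve the [r_i] are the same for all
    [S], so comparing [S] with the set [{x < 0}] of the empty partition
    eliminates them.

    For the size, [|la|] is the sum of [x] over [S] minus the sum over
    [{x < 0}], and [x] is the [g]-difference of [x (x - g) / (2 g)], so this is a
    sum over [B]. *)

Local Open Scope ring_scope.

(** * Sums over finite windows of the integers *)

Local Notation ind b := (Posz (nat_of_bool b)).

(** Stands in for the set of all integers: [L] is later taken so large that the summands, or the
    differences of the summands for two sets, vanish outside. *)
Definition window (L : nat) : seq int :=
  [seq i%:Z - L%:Z | i <- iota 0 L.*2.+1].

Lemma mem_window (L : nat) (x : int) :
  (x \in window L) = (- L%:Z <= x <= L%:Z).
Proof.
apply/mapP/idP => [[i]|hx]; first by rewrite mem_iota => hi ->; lia.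
by exists (absz (x + L%:Z)); [rewrite mem_iota|]; lia.
Qed.

Lemma window_uniq (L : nat) : uniq (window L).
Proof. by rewrite map_inj_uniq ?iota_uniq // => i j; lia. Qed.

Lemma big_uniq_support (R : nmodType) (I : eqType) (u v : seq I) (f : I -> R) :
  uniq u -> uniq v ->
  (forall x, f x != 0 -> (x \in u) = (x \in v)) ->
  \sum_(x <- u) f x = \sum_(x <- v) f x.
Proof.
move=> uu uv huv.
have drop0 (w : seq I) :
    \sum_(x <- w) f x = \sum_(x <- [seq x <- w | f x != 0]) f x.
  rewrite big_filter [RHS]big_mkcond /=.
  by apply: eq_bigr => x _; case: (eqVneq (f x) 0).
rewrite drop0 [RHS]drop0; apply: perm_big; apply: uniq_perm.
- exact: filter_uniq.
- exact: filter_uniq.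
by move=> x; rewrite !mem_filter; case: (boolP (f x != 0)) => //= /huv.
Qed.

(** The window need not be stable under [phi]; it suffices that it contains the support of [f] and
    the preimage of that support. *)
Lemma window_reindex (R : nmodType) (L : nat) (f : int -> R)
    (phi psi : int -> int) :
  cancel phi psi -> cancel psi phi ->
  (forall x, f x != 0 -> - L%:Z <= x <= L%:Z /\ - L%:Z <= psi x <= L%:Z) ->
  \sum_(x <- window L) f (phi x) = \sum_(x <- window L) f x.
Proof.
move=> phiK psiK supp.
transitivity (\sum_(x <- [seq phi x | x <- window L]) f x); first by rewrite [RHS]big_map.
apply: big_uniq_support; rewrite ?(map_inj_uniq (can_inj phiK)) ?window_uniq //.
move=> x /supp[hx hpx]; rewrite mem_window hx.
by apply/mapP; exists (psi x); rewrite ?psiK ?mem_window.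
Qed.

Lemma window_point (R : nmodType) (L : nat) (y : int) (f : int -> R) :
  - L%:Z <= y <= L%:Z ->
  \sum_(x <- window L) (if x == y then f x else 0) = f y.
Proof.
move=> hy; rewrite (bigD1_seq y) ?window_uniq ?mem_window //= eqxx.
by rewrite big1 ?addr0 // => x /negPf ->.
Qed.

Lemma sum_square_split (R : nmodType) (n : nat) (F : nat -> nat -> R) :
  \sum_(1 <= i < n.+1) \sum_(1 <= j < n.+1) F i j =
  \sum_(1 <= i < n.+1) F i i +
  \sum_(1 <= i < n.+1) \sum_(i.+1 <= j < n.+1) (F i j + F j i).
Proof.
elim: n => [|n IHn]; first by rewrite !big_geq ?addr0.
rewrite big_nat_recr //= (@big_nat_recr _ _ _ n.+1 1%N (fun j => F n.+1 j)) //=.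
under eq_big_nat => i hi do rewrite big_nat_recr //=.
rewrite big_split /= IHn.
rewrite [X in _ = X + _]big_nat_recr //= [X in _ = _ + X]big_nat_recr //=.
rewrite [X in _ = _ + (_ + X)]big_geq // addr0.
under [X in _ = _ + X]eq_big_nat => i hi do
  (rewrite big_nat_recr /=; last by case/andP: hi).
rewrite [X in _ = _ + X]big_split /= [X in _ = _ + (_ + X)]big_split /=.
rewrite -!addrA; congr (_ + _).
by rewrite [RHS]addrC !addrA.
Qed.

(** * Symmetric cores as sets of integers *)

(** What the argument uses of [S], isolated so that it also applies to the set of the empty
    partition. Outside [[-K, K]] the set agrees with the negative integers; [sc_edge] describes
    [B]. *)
Record symmetric_core (t K : nat) (s : int -> bool) (r : nat -> int) : Prop := {
  sc_low : forall x, x < - K%:Z -> s x;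
  sc_high : forall x, K%:Z < x -> ~~ s x;
  sc_sym : forall x, x != 0 -> s (- x) = ~~ s x;
  sc_0 : ~~ s 0;
  sc_core : forall x, s x -> s (x - (2 * t + 2)%:Z);
  sc_pos : forall i, (1 <= i < t.+1)%N -> 0 < r i;
  sc_decr : forall i j, (1 <= i)%N -> (i < j < t.+1)%N -> r j < r i;
  sc_edge : forall x, (s (x - (2 * t + 2)%:Z) && ~~ s x) =
    (x \in 0 :: (t.+1)%:Z ::
       [seq (t.+1)%:Z + r i | i <- index_iota 1 t.+1] ++
       [seq (t.+1)%:Z - r i | i <- index_iota 1 t.+1])
}.

(* The arguments of [tau] in the numerators of the right-hand side, i.e. the
   values of the positive roots of type B at [r]. *)
Definition root_values (t : nat) (r : nat -> int) : seq int :=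
  [seq r i | i <- index_iota 1 t.+1] ++
  [seq r i - r j | i <- index_iota 1 t.+1, j <- index_iota i.+1 t.+1] ++
  [seq r i + r j | i <- index_iota 1 t.+1, j <- index_iota i.+1 t.+1].

Lemma big_root_values (R : Type) (idx : R) (op : Monoid.com_law idx)
    (t : nat) (r : nat -> int) (F : int -> R) :
  \big[op/idx]_(x <- root_values t r) F x =
  op (\big[op/idx]_(1 <= i < t.+1) F (r i))
     (\big[op/idx]_(1 <= i < t.+1) \big[op/idx]_(i.+1 <= j < t.+1)
        op (F (r i - r j)) (F (r i + r j))).
Proof.
rewrite /root_values !big_cat /= big_map !big_allpairs_dep /=; congr (op _ _).
by rewrite -big_split /=; apply: eq_bigr => i _; rewrite -big_split.
Qed.

(** * Counting pairs by their difference *)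

Lemma count_ind (I : Type) (P : pred I) (u : seq I) :
  (count P u)%:Z = \sum_(x <- u) ind (P x).
Proof.
rewrite -sum1_count big_mkcond /= -natz natr_sum.
by apply: eq_bigr => x _; case: (P x).
Qed.

Definition npairs (L : nat) (s : int -> bool) (m : int) : int :=
  \sum_(x <- window L) ind (s x && ~~ s (x - m)).
(** With [y = x - m], the condition [m <= 2 * x] reads [x + y >= 0], which will characterise the
    boxes with [eps = 1]. *)
Definition npairs_pos (L : nat) (s : int -> bool) (m : int) : int :=
  \sum_(x <- window L) ind [&& s x, ~~ s (x - m) & m <= 2 * x].
Definition npairs_neg (L : nat) (s : int -> bool) (m : int) : int :=
  \sum_(x <- window L) ind [&& s x, ~~ s (x - m) & 2 * x < m].
(* The number of pairs [(m, 0)] and [(m / 2, - m / 2)], the only ones with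
   difference [m] that are not exchanged in twos by [(x, y) |-> (- y, - x)]. *)
Definition excess (L : nat) (s : int -> bool) (m : int) : int :=
  ind (s m) + \sum_(x <- window L) ind ((2 * x == m) && s x).

Section SymmetricCore.

Variables (t K : nat) (s : int -> bool) (r : nat -> int).
Hypothesis hs : symmetric_core t K s r.

Let g : nat := (2 * t + 2)%N.
Let edge (x : int) := s (x - g%:Z) && ~~ s x.
Let edges : seq int := 0 :: (t.+1)%:Z ::
       [seq (t.+1)%:Z + r i | i <- index_iota 1 t.+1] ++
       [seq (t.+1)%:Z - r i | i <- index_iota 1 t.+1].

(** Otherwise [g = t + 1 + r i] would lie in [B], forcing [0] into the set. *)
Lemma root_neq_half i : (1 <= i < t.+1)%N -> r i != (t.+1)%:Z.
Proof.
move=> hi; apply/eqP => hr.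
have : edge g%:Z.
  rewrite /edge (sc_edge hs) !inE mem_cat; apply/orP; right; apply/orP; right.
  by apply/orP; left; apply/mapP; exists i; rewrite ?mem_index_iota // /g; lia.
by rewrite /edge subrr => /andP[h0 _]; move: (sc_0 hs); rewrite h0.
Qed.

Lemma root_inj i j : (1 <= i < t.+1)%N -> (1 <= j < t.+1)%N -> r i = r j -> i = j.
Proof.
move=> hi hj hij; have := @sc_decr _ _ _ _ hs i j; have := @sc_decr _ _ _ _ hs j i.
by case: (ltngtP i j) => hlt // h1 h2; [have := h2 _ _ | have := h1 _ _]; lia.
Qed.

Lemma edges_uniq : uniq edges.
Proof.
have rp := sc_pos hs.
rewrite /edges /= inE mem_cat cat_uniq !negb_or.
rewrite !map_inj_in_uniq ?iota_uniq ?andbT; last first.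
- by move=> i j; rewrite !mem_index_iota => hi hj e; apply: root_inj => //; lia.
- by move=> i j; rewrite !mem_index_iota => hi hj e; apply: root_inj => //; lia.
apply/and4P; split=> //=.
- apply/andP; split; apply/mapP => -[i]; rewrite mem_index_iota => hi;
  have := rp _ hi; have := root_neq_half hi; lia.
- rewrite mem_cat negb_or; apply/andP; split; apply/mapP => -[i];
  rewrite mem_index_iota => hi; have := rp _ hi; lia.
- apply/hasPn => x /mapP[i]; rewrite mem_index_iota => hi ->.
  apply/mapP => -[j]; rewrite mem_index_iota => hj.
  have := rp _ hi; have := rp _ hj; lia.
Qed.

Lemma edge_bound x : edge x -> - K%:Z <= x <= K%:Z + g%:Z.
Proof.
move=> /andP[h1 h2].
have := @sc_low _ _ _ _ hs x; have := @sc_high _ _ _ _ hs (x - g%:Z).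
rewrite h1 (negPf h2); lia.
Qed.

Lemma edge_sum (R : nmodType) (L : nat) (f : int -> R) : (K + g <= L)%N ->
  \sum_(x <- window L) (if edge x then f x else 0) =
  f 0 + f (t.+1)%:Z +
  \sum_(1 <= i < t.+1) (f ((t.+1)%:Z + r i) + f ((t.+1)%:Z - r i)).
Proof.
move=> hL; transitivity (\sum_(x <- edges) f x).
  transitivity (\sum_(x <- edges) (if edge x then f x else 0)).
    apply: big_uniq_support; rewrite ?window_uniq ?edges_uniq // => x.
    case: ifP => [he _|]; last by rewrite eqxx.
    have := edge_bound he; rewrite mem_window -(sc_edge hs) -/(edge x) he; lia.
  by rewrite big_seq [RHS]big_seq; apply: eq_bigr => x; rewrite -(sc_edge hs) -/(edge x) => ->.
by rewrite /edges !big_cons big_cat /= !big_map addrA -big_split.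
Qed.

(** By [sc_core], [s x] never holds without [s (x - g)], so the difference is never negative. *)
Lemma ind_edge x : ind (edge x) = ind (s (x - g%:Z)) - ind (s x).
Proof.
rewrite /edge; have := @sc_core _ _ _ _ hs x.
by case: (s x) => [/(_ isT)->|] //=; case: (s _).
Qed.

Lemma ind_edge_sum y :
  ind (edge y) = ind (y == 0) + ind (y == (t.+1)%:Z) +
  \sum_(1 <= i < t.+1)
     (ind (y == (t.+1)%:Z + r i) + ind (y == (t.+1)%:Z - r i)).
Proof.
(* The term [absz y] puts [y] in the window, so that [edge_sum] can be applied to the point mass at
   [y]. *)
pose L := (K + g + absz y)%N.
have hL : (K + g <= L)%N by rewrite /L; lia.
rewrite -(edge_sum (fun x => ind (y == x)) hL).
rewrite -(@window_point _ L y (fun x => ind (edge x))); last by rewrite /L; lia.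
apply: eq_bigr => x _; rewrite eq_sym; case: (eqVneq y x) => //= _; first by case: (edge x).
by case: (edge x).
Qed.

Lemma ind_edge_off y : y != 0 -> y != (t.+1)%:Z ->
  ind (edge y) = \sum_(1 <= i < t.+1)
     (ind (y == (t.+1)%:Z + r i) + ind (y == (t.+1)%:Z - r i)).
Proof. by move=> /negPf y0 /negPf yt; rewrite ind_edge_sum y0 yt !add0r. Qed.

(** The first difference at [k] counts the [x] in [B] with [s (x + k)]. Differencing again, between
    [k = m - g] and [k = m], replaces [s] by [edge]. *)
Lemma npairs_second_difference (L : nat) (m : int) : (K + g <= L)%N ->
  (absz m + 2 * g + K <= L)%N ->
  npairs L s (m + g%:Z) + npairs L s (m - g%:Z) - 2 * npairs L s m =
  ind (edge m) + ind (edge ((t.+1)%:Z + m)) +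
  \sum_(1 <= i < t.+1)
     (ind (edge ((t.+1)%:Z + r i + m)) + ind (edge ((t.+1)%:Z - r i + m))).
Proof.
move=> hL hm.
have diff (k : int) : (absz k + g + K <= L)%N ->
    npairs L s k - npairs L s (k + g%:Z) =
    \sum_(x <- window L) (if edge x then ind (s (x + k)) else 0).
  move=> hk; rewrite -sumrB.
  transitivity (\sum_(x <- window L) (if edge (x - k) then ind (s x) else 0)).
    apply: eq_bigr => x _; rewrite opprD addrA.
    have := ind_edge (x - k); rewrite /edge.
    by case: (s x) (s (x - k)) (s (x - k - g%:Z)) => [] [] [].
  rewrite -[RHS](@window_reindex _ L _ (fun x => x - k) (fun x => x + k)) /=.
  - by apply: eq_bigr => x _; rewrite subrK.
  - exact: subrK.
  - exact: addrK.
  move=> x; case: ifP => [/edge_bound hx _|]; last by rewrite eqxx.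
  by split; lia.
have hm1 : (absz m + g + K <= L)%N by lia.
have hm2 : (absz (m - g%:Z)%R + g + K <= L)%N by lia.
have e1 := diff _ hm1; have := diff _ hm2; rewrite subrK => e2.
rewrite (edge_sum _ hL) in e1; rewrite (edge_sum _ hL) in e2.
transitivity ((npairs L s (m - g%:Z) - npairs L s m)
   - (npairs L s m - npairs L s (m + g%:Z))); first by ring.
rewrite e1 e2 opprD addrACA -sumrB; congr (_ + _).
  by rewrite !ind_edge !addrA !add0r; ring.
by apply: eq_bigr => i _; rewrite !ind_edge !addrA; ring.
Qed.

(** Both sides count the pairs in [B] with difference [m]. Pairs from [0] give [edge m], and pairs
    ending at [0] give, after reflection, [edge (m + g)]. Among [t + 1] and [t + 1 +- r i], each
    positive root occurs twice and each [2 r i] once. *)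
Lemma edge_pairs (m : int) : 0 < m ->
  ind (edge m) + ind (edge ((t.+1)%:Z + m)) +
  \sum_(1 <= i < t.+1)
     (ind (edge ((t.+1)%:Z + r i + m)) + ind (edge ((t.+1)%:Z - r i + m))) =
  2 * (count_mem m (root_values t r))%:Z
  + ind (edge m) + ind (edge (m + g%:Z))
  + \sum_(1 <= i < t.+1) ind (r i + r i == m).
Proof.
move=> m0; have rp := @sc_pos _ _ _ _ hs; have rd := @sc_decr _ _ _ _ hs.
have e1 : ind (edge ((t.+1)%:Z + m)) = \sum_(1 <= i < t.+1) ind (r i == m).
  rewrite ind_edge_off; [|lia|lia].
  by apply: eq_big_nat => i /rp; lia.
have e2 : ind (edge (m + g%:Z)) = \sum_(1 <= i < t.+1) ind (r i == (t.+1)%:Z + m).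
  rewrite ind_edge_off; [|lia|lia].
  by apply: eq_big_nat => i /rp; lia.
have e3 : \sum_(1 <= i < t.+1) ind (edge ((t.+1)%:Z + r i + m)) =
    \sum_(1 <= i < t.+1) \sum_(1 <= j < t.+1) ind (r j - r i == m).
  apply: eq_big_nat => i /rp hi.
  rewrite ind_edge_off; [|lia|lia].
  by apply: eq_big_nat => j /rp; lia.
have e4 : \sum_(1 <= i < t.+1) ind (edge ((t.+1)%:Z - r i + m)) =
    \sum_(1 <= i < t.+1) ind (r i == (t.+1)%:Z + m) +
    \sum_(1 <= i < t.+1) ind (r i == m) +
    \sum_(1 <= i < t.+1) \sum_(1 <= j < t.+1) ind (r i + r j == m) +
    \sum_(1 <= i < t.+1) \sum_(1 <= j < t.+1) ind (r i - r j == m).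
  rewrite -!big_split /=; apply: eq_big_nat => i /rp hi.
  rewrite ind_edge_sum -!addrA; congr (_ + (_ + _)); try lia.
  by rewrite -big_split /=; apply: eq_big_nat => j /rp hj; congr (_ + _); lia.
rewrite big_split /= e1 e2 e3 e4 !sum_square_split count_ind big_root_values /=.
have z1 : \sum_(1 <= i < t.+1) ind (r i - r i == m) = 0.
  by rewrite big_nat big1 // => i _; lia.
(* As [r] decreases, [r j - r i] is negative for [i < j] and never equals [m]. *)
have z2 : \sum_(1 <= i < t.+1) \sum_(i.+1 <= j < t.+1)
     (ind (r j - r i == m) + ind (r i - r j == m)) =
   \sum_(1 <= i < t.+1) \sum_(i.+1 <= j < t.+1) ind (r i - r j == m).
  apply: eq_big_nat => i hi; apply: eq_big_nat => j hj.
  by have := rd i j; lia.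
have z3 : \sum_(1 <= i < t.+1) \sum_(i.+1 <= j < t.+1)
     (ind (r i - r j == m) + ind (r j - r i == m)) =
   \sum_(1 <= i < t.+1) \sum_(i.+1 <= j < t.+1) ind (r i - r j == m).
  apply: eq_big_nat => i hi; apply: eq_big_nat => j hj.
  by have := rd i j; lia.
have z4 : \sum_(1 <= i < t.+1) \sum_(i.+1 <= j < t.+1)
     (ind (r i + r j == m) + ind (r j + r i == m)) =
   2 * \sum_(1 <= i < t.+1) \sum_(i.+1 <= j < t.+1) ind (r i + r j == m).
  rewrite mulr_sumr; apply: eq_bigr => i hi.
  by rewrite mulr_sumr; apply: eq_bigr => j hj; rewrite (addrC (r j)); ring.
have z5 : \sum_(1 <= i < t.+1) \sum_(i.+1 <= j < t.+1)
     (ind (r i - r j == m) + ind (r i + r j == m)) =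
   \sum_(1 <= i < t.+1) \sum_(i.+1 <= j < t.+1) ind (r i - r j == m) +
   \sum_(1 <= i < t.+1) \sum_(i.+1 <= j < t.+1) ind (r i + r j == m).
  by rewrite -big_split /=; apply: eq_bigr => i _; rewrite big_split.
rewrite z1 z2 z3 z4 z5; ring.
Qed.

(** Since [m > 0], the only elements [x] of [B] with [2 x - g = m] are those [t + 1 + r i] with
    [2 r i = m]. Summing over [B] and applying [ind_edge] gives the difference. *)
Lemma sum_double_root (L : nat) (m : int) : 0 < m ->
  (K + absz m + 2 * g <= L)%N ->
  \sum_(1 <= i < t.+1) ind (r i + r i == m) =
  \sum_(x <- window L) ind ((2 * x == m - g%:Z) && s x) -
  \sum_(x <- window L) ind ((2 * x == m + g%:Z) && s x).
Proof.
move=> m0 hL.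
have hL' : (K + g <= L)%N by lia.
have := edge_sum (fun x : int => ind (2 * x - g%:Z == m)) hL'.
rewrite [X in _ = X + _ + _](_ : _ = 0); last by lia.
rewrite [X in _ = _ + X + _](_ : _ = 0); last by lia.
rewrite [X in _ = _ + X](_ : _ = \sum_(1 <= i < t.+1) ind (r i + r i == m)); last first.
  by apply: eq_big_nat => i /(sc_pos hs); lia.
rewrite !add0r => <-.
rewrite -(@window_reindex _ L (fun x => ind ((2 * x == m - g%:Z) && s x))
   (fun x => x - g%:Z) (fun x => x + g%:Z)); last first.
- by move=> x; case: (2 * x =P m - g%:Z) => [hx _|]; [split; lia|rewrite eqxx].
- exact: addrK.
- exact: subrK.
rewrite -sumrB; apply: eq_bigr => x _.
rewrite (_ : (2 * (x - g%:Z) == m - g%:Z) = (2 * x - g%:Z == m)); last by lia.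
rewrite (_ : (2 * x == m + g%:Z) = (2 * x - g%:Z == m)); last by lia.
have := ind_edge x; case: (edge x) => /=; case: (2 * x - g%:Z == m) => /=; lia.
Qed.

(** The terms of [edge_pairs] that are not positive roots collect into [excess], which also measures
    the asymmetry between [npairs_pos] and [npairs_neg]. *)
Lemma npairs_root_values (L : nat) (m : int) : 0 < m ->
  (K + absz m + 2 * g <= L)%N ->
  npairs L s (m + g%:Z) + npairs L s (m - g%:Z) - 2 * npairs L s m =
  2 * (count_mem m (root_values t r))%:Z
  + excess L s (m - g%:Z) - excess L s (m + g%:Z).
Proof.
move=> m0 hL; rewrite npairs_second_difference; [|lia|lia].
rewrite edge_pairs // (sum_double_root m0 hL) !ind_edge addrK /excess; ring.
Qed.

Lemma npairsE (L : nat) (m : int) :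
  npairs L s m = npairs_pos L s m + npairs_neg L s m.
Proof.
rewrite /npairs /npairs_pos /npairs_neg -big_split /=; apply: eq_bigr => x _.
by rewrite ltNge; case: (m <= 2 * x); rewrite ?andbF ?andbT /= ?addr0.
Qed.

(** Replacing [x] by [m - x] sends the pair [(x, y)] to [(- y, - x)] and exchanges the two counts.
    The exceptions are [(m, 0)], whose image starts at [0], outside the set, and the fixed pair
    [(m / 2, - m / 2)]. *)
Lemma npairs_pos_sub_neg (L : nat) (m : int) : 0 < m -> (K + absz m <= L)%N ->
  npairs_pos L s m - npairs_neg L s m = excess L s m.
Proof.
move=> m0 hL; have s0 := negPf (sc_0 hs).
rewrite /npairs_neg -(@window_reindex _ L _ (fun x => m - x) (fun x => m - x)); last first.
- move=> x; have := @sc_low _ _ _ _ hs (x - m); have := @sc_high _ _ _ _ hs x.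
  by case: (s x); case: (s (x - m)); rewrite ?eqxx //=; lia.
- by move=> x; rewrite subKr.
- by move=> x; rewrite subKr.
rewrite /npairs_pos /excess -sumrB -(@window_point _ L m (fun x => ind (s x))); last by lia.
rewrite -big_split /=; apply: eq_bigr => x _.
have -> : m - x - m = - x by ring.
have -> : m - x = - (x - m) by ring.
case: (eqVneq x 0) => [->|x0].
  by rewrite oppr0 s0 /= ?andbF /= (_ : (0 == m) = false); lia.
case: (eqVneq x m) => [->|xm]; first by rewrite subrr oppr0 s0; case: (s m) => /=; lia.
rewrite !(sc_sym hs) ?subr_eq0 //.
case: (eqVneq (2 * x) m) => [<-|h] /=; last by case: (s x); case: (s (x - m)) => /=; lia.
by rewrite (_ : x - 2 * x = - x) ?(sc_sym hs) //; [case: (s x) => /=; lia|ring].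
Qed.

(** By [sc_sym] exactly one of [k], [- k] is in the set, and likewise for their halves. The point is
    that the right-hand side does not depend on [s]. *)
Lemma excess_reflect (L : nat) (k : int) : k != 0 -> (absz k <= L)%N ->
  excess L s k + excess L s (- k) =
  1 + \sum_(x <- window L) ind (2 * x == k).
Proof.
move=> k0 hL; rewrite /excess (sc_sym hs) // addrACA; congr (_ + _).
  by case: (s k).
rewrite -(@window_reindex _ L (fun x => ind ((2 * x == - k) && s x)) -%R -%R); last first.
- by move=> x; case: (2 * x =P - k) => [hx _|]; [split; lia|rewrite eqxx].
- exact: opprK.
- exact: opprK.
rewrite -big_split /=; apply: eq_bigr => x _.
case: (eqVneq x 0) => [->|x0]; first by rewrite oppr0 mulr0; lia.
rewrite (sc_sym hs) // mulrN eqr_opp; case: eqP; case: (s x) => /=; lia.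
Qed.

End SymmetricCore.

(** * Comparison of two cores, in particular with the empty partition *)

Definition vacuum (x : int) : bool := x < 0.

Section Comparison.

Variables (t K : nat) (s s' : int -> bool) (r r' : nat -> int).
Hypotheses (hs : symmetric_core t K s r) (hs' : symmetric_core t K s' r').

Let g : nat := (2 * t + 2)%N.

Lemma core_eq_outside x : K%:Z < `|x| -> s x = s' x.
Proof.
move=> hx; case: (ltrP x 0) => h.
  by rewrite !(sc_low hs, sc_low hs') //; lia.
by rewrite !(negPf (sc_high hs _), negPf (sc_high hs' _)) //; lia.
Qed.

(** The shift by [k] would cancel the products [s x && s (x + k)] against [s x && s (x - k)], but
    these have infinite support. Their differences between [s] and [s'] have finite support, so
    there the shift is legitimate. *)
Lemma npairs_opp (L : nat) (k : int) : (K + 2 * absz k <= L)%N ->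
  npairs L s k - npairs L s (- k) = npairs L s' k - npairs L s' (- k).
Proof.
move=> hL.
suff : \sum_(x <- window L) (ind (s x && s (x - k)) - ind (s' x && s' (x - k)))
   = \sum_(x <- window L) (ind (s x && s (x + k)) - ind (s' x && s' (x + k))).
  have h u : npairs L u k - npairs L u (- k) =
     \sum_(x <- window L) (ind (u x && u (x + k))) -
     \sum_(x <- window L) (ind (u x && u (x - k))).
    rewrite -!sumrB; apply: eq_bigr => x _; rewrite opprK.
    by case: (u x); case: (u (x - k)); case: (u (x + k)).
  by rewrite !h !sumrB; lra.
rewrite -(@window_reindex _ L _ (fun x => x + k) (fun x => x - k)); last first.
- move=> x hx; suff : (`|x| <= K%:Z + (absz k)%:Z) by lia.
  rewrite leNgt; apply: contra hx => hx.
  by rewrite !(@core_eq_outside) ?subrr //; lia.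
- exact: subrK.
- exact: addrK.
by apply: eq_bigr => x _; rewrite addrK andbC (andbC (s' _)).
Qed.

(** The counts [npairs_pos] and [npairs_neg] are half of [npairs] plus or minus [excess], so
    [npairs_root_values] applies. For [m < g], [npairs_opp] and [excess_reflect] trade the negative
    difference [m - g] for [g - m], up to terms common to both sets. *)
Lemma net_change_eq (L : nat) (m : int) : 0 < m -> (K + 2 * absz m + 4 * g <= L)%N ->
  npairs_pos L s (g%:Z + m) +
  (if m < g%:Z then npairs_pos L s (g%:Z - m) else npairs_neg L s (m - g%:Z))
  - npairs L s m - (count_mem m (root_values t r))%:Z =
  npairs_pos L s' (g%:Z + m) +
  (if m < g%:Z then npairs_pos L s' (g%:Z - m) else npairs_neg L s' (m - g%:Z))
  - npairs L s' m - (count_mem m (root_values t r'))%:Z.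
Proof.
move=> m0 hL; have hL1 : (K + absz m + 2 * g <= L)%N by lia.
have h2 := npairs_root_values hs m0 hL1; have h2' := npairs_root_values hs' m0 hL1.
rewrite -/g !(addrC m g%:Z) in h2 h2'.
have hgm : 0 < g%:Z + m by lia.
have hLg : (K + absz (g%:Z + m)%R <= L)%N by lia.
have p := npairs_pos_sub_neg hs hgm hLg; have p' := npairs_pos_sub_neg hs' hgm hLg.
have q := npairsE s L (g%:Z + m); have q' := npairsE s' L (g%:Z + m).
case: ltrP => hm.
  have hk : 0 < g%:Z - m by lia.
  have hLk : (K + absz (g%:Z - m)%R <= L)%N by lia.
  have p1 := npairs_pos_sub_neg hs hk hLk; have p1' := npairs_pos_sub_neg hs' hk hLk.
  have q1 := npairsE s L (g%:Z - m); have q1' := npairsE s' L (g%:Z - m).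
  have hk0 : g%:Z - m != 0 by lia.
  have hLk' : (absz (g%:Z - m)%R <= L)%N by lia.
  have e := excess_reflect hs hk0 hLk'; have e' := excess_reflect hs' hk0 hLk'.
  have hLk2 : (K + 2 * absz (g%:Z - m)%R <= L)%N by lia.
  have o := npairs_opp hLk2; rewrite opprB in o e e'.
  lra.
(* For [m = g] the difference [m - g] is [0], where all these counts and the excess vanish. *)
have [hg|hg] := eqVneq m g%:Z.
  rewrite hg subrr in h2 h2' *.
  have z u : npairs L u 0 = 0.
    by rewrite /npairs big1 // => x _; rewrite subr0; case: (u x).
  have z2 u : npairs_neg L u 0 = 0.
    by rewrite /npairs_neg big1 // => x _; rewrite subr0; case: (u x).
  have z3 u : ~~ u 0 -> excess L u 0 = 0.
    move=> /negPf u0; rewrite /excess u0 big1 // => x _.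
    by case: eqP => //= hx; rewrite (_ : x = 0) ?u0 //; lia.
  have := z3 _ (sc_0 hs); have := z3 _ (sc_0 hs').
  have := z s; have := z s'; have := z2 s; have := z2 s'.
  rewrite hg in p p' q q'; lra.
have hk : 0 < m - g%:Z by lia.
have hLk : (K + absz (m - g%:Z)%R <= L)%N by lia.
have p1 := npairs_pos_sub_neg hs hk hLk; have p1' := npairs_pos_sub_neg hs' hk hLk.
have q1 := npairsE s L (m - g%:Z); have q1' := npairsE s' L (m - g%:Z).
lra.
Qed.

Lemma sum_sqr_root_eq (L : nat) : (K + 2 * g <= L)%N ->
  g%:Z * (\sum_(x <- window L) x * ind (s x) - \sum_(x <- window L) x * ind (s' x)) =
  \sum_(1 <= i < t.+1) r i ^+ 2 - \sum_(1 <= i < t.+1) r' i ^+ 2.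
Proof.
move=> hL; have hL' : (K + g <= L)%N by lia.
have gE : g%:Z = 2 * (t.+1)%:Z by rewrite /g; lia.
(* Chosen so that [q (x + g) - q x = 2 g x] and [q (t + 1 +- r) = r ^ 2 - (t + 1) ^ 2]. *)
pose q (x : int) := x * (x - g%:Z).
have edge_q u ru (hu : symmetric_core t K u ru) :
    \sum_(x <- window L) q x * (ind (u (x - g%:Z)) - ind (u x)) =
    - (t.+1)%:Z ^+ 2 + \sum_(1 <= i < t.+1) (2 * (ru i ^+ 2) - 2 * (t.+1)%:Z ^+ 2).
  transitivity (\sum_(x <- window L)
      (if u (x - g%:Z) && ~~ u x then q x else 0)).
    apply: eq_bigr => x _; have := ind_edge hu x; rewrite -/g => <-.
    by case: ifP => _; rewrite ?mulr1 ?mulr0.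
  rewrite (edge_sum hu q hL') /q mul0r add0r gE; congr (_ + _); first by ring.
  by apply: eq_bigr => i _; ring.
have := edge_q _ _ hs; have := edge_q _ _ hs'.
rewrite !sumrB -!mulr_sumr => e' e.
(* Only the difference of the two sets has finite support, so the shift is made on it. *)
have shift : \sum_(x <- window L) q x * (ind (s (x - g%:Z)) - ind (s' (x - g%:Z))) =
    \sum_(x <- window L) q (x + g%:Z) * (ind (s x) - ind (s' x)).
  rewrite -[RHS](@window_reindex _ L _ (fun x => x - g%:Z) (fun x => x + g%:Z)).
  - by apply: eq_bigr => x _; rewrite subrK.
  - exact: subrK.
  - exact: addrK.
  move=> x hx; suff : (`|x| <= K%:Z) by lia.
  rewrite leNgt; apply: contra hx => hx.
  by rewrite core_eq_outside // subrr mulr0.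
have sum : \sum_(x <- window L) q x * (ind (s (x - g%:Z)) - ind (s x)) -
  \sum_(x <- window L) q x * (ind (s' (x - g%:Z)) - ind (s' x)) =
  2 * (g%:Z * (\sum_(x <- window L) x * ind (s x) - \sum_(x <- window L) x * ind (s' x))).
  rewrite -!sumrB !mulr_sumr.
  transitivity (\sum_(x <- window L) q (x + g%:Z) * (ind (s x) - ind (s' x)) -
     \sum_(x <- window L) q x * (ind (s x) - ind (s' x))).
    by rewrite -shift -sumrB; apply: eq_bigr => x _; ring.
  by rewrite -sumrB; apply: eq_bigr => x _; rewrite /q; ring.
by rewrite e e' in sum; lra.
Qed.

End Comparison.

(** For the empty partition [B] is [{0, ..., g - 1}], whose elements above [t + 1] are the [g - i]
    with [1 <= i <= t]. *)
Lemma vacuum_core (t K : nat) : symmetric_core t K vacuum (fun i => (t.+1)%:Z - i%:Z).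
Proof.
split; rewrite /vacuum => //; try lia.
move=> x; rewrite !inE mem_cat; apply/idP/idP => [hx|].
  have [->|x0] := eqVneq x 0; first by [].
  have [->|xt] := eqVneq x (t.+1)%:Z; first by rewrite ?orbT.
  rewrite /=; case: (ltrP x (t.+1)%:Z) => h.
    apply/orP; right; apply/mapP; exists (absz x); rewrite ?mem_index_iota; lia.
  apply/orP; left; apply/mapP; exists (absz ((2 * t + 2)%:Z - x)%R); rewrite ?mem_index_iota; lia.
case/or3P => [/eqP ->|/eqP ->|/orP[]/mapP[i]]; [lia|lia| |];
  rewrite mem_index_iota => hi ->; lia.
Qed.

Lemma npairs_vacuum (L : nat) (m : int) : 0 <= m ->
  [/\ npairs L vacuum m = 0, npairs_pos L vacuum m = 0 & npairs_neg L vacuum m = 0].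
Proof.
rewrite /npairs /npairs_pos /npairs_neg /vacuum => m0.
by split; rewrite big1 // => x _; lia.
Qed.

(** * Partitions, their boxes and the doubled distinct condition *)

(* Membership in the infinite set of the [la_i - i], [i >= 1]; an [i] beyond
   the length that gives [x] equals [`|x|]. *)
Definition maya (la : seq nat) (x : int) : bool :=
  x \in [seq (part la i)%:Z - i%:Z | i <- iota 1 (size la + absz x)].

Lemma part_default la i : (size la < i)%N -> part la i = 0%N.
Proof. by move=> hi; rewrite /part nth_default //; case: i hi. Qed.

Lemma mayaP la (x : int) :
  reflect (exists2 i : nat, (0 < i)%N & x = (part la i)%:Z - i%:Z) (maya la x).
Proof.
apply: (iffP mapP) => [[i]|[i i0 ->]].
  by rewrite mem_iota => hi ->; exists i => //; lia.
exists i => //; rewrite mem_iota; have := @part_default la i; lia.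
Qed.

Lemma leq_part_conjpart la i j : is_partition la -> (0 < i)%N -> (0 < j)%N ->
  (j <= part la i)%N = (i <= conjpart la j)%N.
Proof.
rewrite /part /conjpart => /andP[+ _] i0 j0.
case: i i0 => // i _; rewrite succnK; elim: la i => [|x l IH] i /=.
  by rewrite nth_nil; lia.
rewrite path_sortedE; last by move=> a b c; rewrite /geq /=; lia.
move=> /andP[/allP xl /IH{}IH].
have hc : (j <= x)%N = false -> count (leq j) l = 0%N.
  move=> jx; apply/eqP; rewrite -leqn0 leqNgt -has_count; apply/hasPn => y /xl.
  by rewrite /geq /=; lia.
case: i => [|i] /=; first by case: (boolP (j <= x)%N) => h; rewrite ?add1n // hc //; lia.
rewrite IH; case: (boolP (j <= x)%N) => h; rewrite ?add1n // hc //; lia.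
Qed.

Lemma mem_boxes la u :
  (u \in boxes la) = [&& (0 < u.1)%N, (0 < u.2)%N & (u.2 <= part la u.1)%N].
Proof.
case: u => i j; apply/allpairsPdep/and3P => /= [[a [b []]]|[i0 j0 hj]].
  by rewrite !mem_iota => ha hb [-> ->]; split; lia.
exists i, j; split; rewrite ?mem_iota //; last by lia.
by have := @part_default la i; lia.
Qed.

Lemma boxes_uniq la : uniq (boxes la).
Proof.
apply: allpairs_uniq_dep; rewrite ?iota_uniq //; try by move=> i _; exact: iota_uniq.
by move=> [a b] [c d] _ _ /= [-> ->].
Qed.

Lemma psizeE la L : (size la <= L)%N ->
  psize la = (\sum_(i <- iota 1 L) part la i)%N.
Proof.
move=> hL; rewrite -[in iota _ _](addn0 1%N) iotaDl big_map.
rewrite -[in iota _ _](subnKC hL) iotaD big_cat /= [X in (_ + X)%N]big1_seq ?addn0.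
  by rewrite /psize sumnE (big_nth 0%N) /index_iota subn0.
by move=> i /andP[_]; rewrite mem_iota => hi; rewrite part_default; lia.
Qed.

Section Partition.

Variable la : seq nat.
Hypothesis la_part : is_partition la.

Let galois i j : (0 < i)%N -> (0 < j)%N ->
  (j <= part la i)%N = (i <= conjpart la j)%N.
Proof. exact: leq_part_conjpart. Qed.

Lemma part_anti i j : (0 < i <= j)%N -> (part la j <= part la i)%N.
Proof.
move=> hij; case: (posnP (part la j)) => [->//|h].
by rewrite galois //; [have := @galois j (part la j)|]; lia.
Qed.

Lemma conjpart_anti i j : (0 < i <= j)%N -> (conjpart la j <= conjpart la i)%N.
Proof.
move=> hij; case: (posnP (conjpart la j)) => [->//|h].
by rewrite -galois //; [have := @galois (conjpart la j) j|]; lia.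
Qed.

Lemma maya_part i : (0 < i)%N -> maya la ((part la i)%:Z - i%:Z).
Proof. by move=> i0; apply/mayaP; exists i. Qed.

Lemma maya_conjpart j : (0 < j)%N -> ~~ maya la (j%:Z - 1 - (conjpart la j)%:Z).
Proof. by move=> j0; apply/mayaP => -[i i0]; have := galois i0 j0; lia. Qed.

Lemma mayaPn (y : int) :
  reflect (exists2 j : nat, (0 < j)%N & y = j%:Z - 1 - (conjpart la j)%:Z) (~~ maya la y).
Proof.
apply: (iffP idP) => [hy|[j j0 ->]]; last exact: maya_conjpart.
have ex : exists i : nat, (part la i.+1)%:Z - i.+1%:Z <= y.
  exists (size la + absz y)%N; rewrite part_default; lia.
(* This [i] is the number of elements of [S] above [y]; then [j = y + 1 + i] is the column with
   [conjpart la j = i]. *)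
pose i := ex_minn ex; have [hi imin] : (part la i.+1)%:Z - i.+1%:Z <= y /\
    forall k : nat, (part la k.+1)%:Z - k.+1%:Z <= y -> (i <= k)%N.
  by rewrite /i; case: ex_minnP.
have hne : (part la i.+1)%:Z - i.+1%:Z != y.
  by apply: contraNneq hy => <-; apply: maya_part.
have j0 : (0 < absz (y + 1 + i%:Z)%R)%N by lia.
exists (absz (y + 1 + i%:Z)%R) => //.
suff -> : conjpart la (absz (y + 1 + i%:Z)%R) = i by lia.
have := @galois i.+1 _ isT j0; have : (0 < i)%N -> (part la i)%:Z - i%:Z > y.
  move=> i0; rewrite ltNge; apply/negP => hle.
  by have := imin i.-1; rewrite prednK //; lia.
have := @galois i _ _ j0; lia.
Qed.

Lemma part_sub_inj i j : (0 < i)%N -> (0 < j)%N ->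
  (part la i)%:Z - i%:Z = (part la j)%:Z - j%:Z -> i = j.
Proof.
move=> i0 j0; have := @part_anti i j; have := @part_anti j i.
by case: (ltngtP i j); lia.
Qed.

Lemma sub_conjpart_inj i j : (0 < i)%N -> (0 < j)%N ->
  i%:Z - 1 - (conjpart la i)%:Z = j%:Z - 1 - (conjpart la j)%:Z -> i = j.
Proof.
move=> i0 j0; have := @conjpart_anti i j; have := @conjpart_anti j i.
by case: (ltngtP i j); lia.
Qed.

Lemma maya_low (x : int) : x < - (size la)%:Z -> maya la x.
Proof. by move=> hx; apply/mayaP; exists (absz x); rewrite ?part_default; lia. Qed.

Lemma part_leq_psize i : (part la i <= psize la)%N.
Proof.
rewrite /part /psize; elim: la i.-1 => [|x l IH] [|k] //=; first by lia.
by have := IH k; lia.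
Qed.

Lemma maya_high (x : int) : (psize la)%:Z < x -> ~~ maya la x.
Proof. by move=> hx; apply/mayaP => -[i i0]; have := part_leq_psize i; lia. Qed.

Lemma size_leq_psize : (size la <= psize la)%N.
Proof.
case/andP: la_part => _; rewrite /psize; elim: la => //= x l IH /andP[x0 /IH]; lia.
Qed.

Lemma hook_gt0 u : u \in boxes la -> 0 < hook la u.
Proof.
by case: u => i j; rewrite mem_boxes /hook /= => /and3P[i0 j0]; have := galois i0 j0; lia.
Qed.

(** The box [(i, j)] corresponds to the pair of [part la i - i] in [S] and [j - 1 - conjpart la j]
    outside, whose difference is the hook length. [Q] leaves room for the condition on [eps]. *)
Lemma count_boxes (L : nat) (m : int) (Q : pred int) :
  0 < m -> (psize la + absz m <= L)%N ->
  (count (fun u => (hook la u == m) && Q ((part la u.1)%:Z - u.1%:Z)) (boxes la))%:Z =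
  \sum_(x <- window L) ind [&& maya la x, ~~ maya la (x - m) & Q x].
Proof.
move=> m0 hL; have hsz := size_leq_psize.
transitivity (count (fun x => [&& maya la x, ~~ maya la (x - m) & Q x]) (window L))%:Z; last first.
  exact: count_ind.
congr Posz; rewrite -!size_filter -(size_map (fun u : nat * nat => (part la u.1)%:Z - u.1%:Z)).
apply: perm_size; apply: uniq_perm.
- rewrite map_inj_in_uniq ?filter_uniq ?boxes_uniq //.
  move=> [i j] [k l]; rewrite !mem_filter !mem_boxes /hook /=.
  move=> /andP[/andP[/eqP h1 _] /and3P[i0 j0 _]].
  move=> /andP[/andP[/eqP h2 _] /and3P[k0 l0 _]] e.
  have eik : i = k by apply: part_sub_inj e; lia.
  have ejl : j = l by apply: sub_conjpart_inj; lia.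
  by rewrite eik ejl.
- by rewrite filter_uniq ?window_uniq.
move=> x; rewrite mem_filter mem_window; apply/mapP/idP.
  move=> [[i j]]; rewrite mem_filter mem_boxes /hook /= => /andP[/andP[/eqP hm hQ] /and3P[i0 j0 hj] ->].
  rewrite hQ maya_part //= (_ : _ - m = j%:Z - 1 - (conjpart la j)%:Z); last by lia.
  rewrite maya_conjpart //=.
  have := part_leq_psize i; have := @part_default la i; lia.
move=> /andP[/and3P[/mayaP[i i0 hx] /mayaPn[j j0 hy] hQ] hb].
exists (i, j) => //; rewrite mem_filter mem_boxes /hook /= -hx hQ i0 j0 galois //.
have := galois i0 j0; lia.
Qed.

(** Inside the window both sets are listed by [1 <= i <= L], and the [i]-th elements [part la i - i]
    and [- i] differ by [part la i]. *)
Lemma psize_maya (L : nat) : (psize la <= L)%N ->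
  (psize la)%:Z = \sum_(x <- window L) x * ind (maya la x)
    - \sum_(x <- window L) x * ind (vacuum x).
Proof.
move=> hL; have hsz := size_leq_psize; have hL' := leq_trans hsz hL.
have filt (P : pred int) : \sum_(x <- window L) x * ind (P x) =
    \sum_(x <- [seq x <- window L | P x]) x.
  rewrite big_filter [RHS]big_mkcond /=; apply: eq_bigr => x _.
  by case: (P x); rewrite ?mulr1 ?mulr0.
have e1 : perm_eq [seq x <- window L | maya la x]
    [seq (part la i)%:Z - i%:Z | i <- iota 1 L].
  apply: uniq_perm; rewrite ?filter_uniq ?window_uniq ?map_inj_in_uniq ?iota_uniq //.
    by move=> i j; rewrite !mem_iota => hi hj; apply: part_sub_inj; lia.
  move=> x; rewrite mem_filter mem_window; apply/andP/mapP.
    move=> [/mayaP[i i0 ->] hx]; exists i => //; rewrite mem_iota.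
    have := @part_default la i; lia.
  move=> [i]; rewrite mem_iota => hi ->; split; first by apply: maya_part; lia.
  have := part_leq_psize i; lia.
have e2 : perm_eq [seq x <- window L | vacuum x] [seq - i%:Z | i <- iota 1 L].
  apply: uniq_perm; rewrite ?filter_uniq ?window_uniq ?map_inj_in_uniq ?iota_uniq //.
    by move=> i j _ _; lia.
  move=> x; rewrite mem_filter mem_window /vacuum; apply/andP/mapP.
    by move=> [x0 hx]; exists (absz x); rewrite ?mem_iota; lia.
  by move=> [i]; rewrite mem_iota => hi ->; split; lia.
rewrite !filt (perm_big _ e1) (perm_big _ e2) /= !big_map -sumrB.
under eq_bigr => i _ do rewrite opprK subrK.
by rewrite (psizeE hL') -natz natr_sum; apply: eq_bigr => i _; rewrite natz.
Qed.

Lemma leq_durfee i : (0 < i)%N -> (i <= durfee la)%N = (i <= part la i)%N.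
Proof.
move=> i0; apply/idP/idP => [|hi]; last first.
  rewrite /durfee; have hs : (i < (size la).+1)%N by have := @part_default la i; lia.
  exact: (@leq_bigmax_cond _ (fun s : 'I_(size la).+1 => (s <= part la s)%N)
    (fun s => s : nat) (Ordinal hs)).
apply: contraLR; rewrite -!ltnNge => hi.
rewrite -(prednK i0) ltnS; apply/bigmax_leqP => s hs.
rewrite -ltnS prednK // ltnNge; apply/negP => his.
by have := @part_anti i s; lia.
Qed.

Section DoubledDistinct.

Hypothesis la_DD : is_DD la.

Let DDE i : (0 < i)%N -> (i <= part la i)%N -> part la i = (conjpart la i).+1.
Proof. by move=> i0 hi; apply: la_DD; rewrite i0 leq_durfee. Qed.

(** If [part la i = i], the diagonal box gives [conjpart la i >= i], and the doubled distinct
    condition then forces [part la i > i]. *)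
Lemma maya0 : ~~ maya la 0.
Proof.
apply/mayaP => -[i i0 hi]; have hle : (i <= part la i)%N by lia.
by have := DDE i0 hle; have := galois i0 i0; lia.
Qed.

(** For a row meeting the diagonal, [part la i - i] is the negative of the non-member
    [i - 1 - conjpart la i]. *)
Lemma maya_opp (x : int) : x != 0 -> maya la (- x) = ~~ maya la x.
Proof.
suff pos (y : int) : 0 < y -> maya la y = ~~ maya la (- y).
  by case: (ltrgtP x 0) => // hx _; [rewrite (pos (- x)) ?opprK|rewrite (pos x) ?negbK]; lia.
move=> y0; apply/idP/mayaPn => [/mayaP[i i0 hy]|[j j0 hy]].
  by exists i => //; have := @DDE i i0; lia.
apply/mayaP; exists j => //; have := galois j0 j0; have := @DDE j j0; lia.
Qed.

(** The claim is that [i <= j] iff [x + y >= 0]. If [(i, i)] and [(j, j)] are boxes, then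
    [y = j - part la j] and the order of [i] and [j] decides the sign. If one is missing, [x] and
    [y] are both nonnegative for [i <= j] and both negative for [i > j]. *)
Lemma eps_eq1 u : u \in boxes la ->
  (eps u == 1) = (hook la u <= 2 * ((part la u.1)%:Z - u.1%:Z)).
Proof.
case: u => i j; rewrite mem_boxes /hook /eps /= => /and3P[i0 j0 hij].
rewrite [LHS](_ : _ = (i <= j)%N); last by case: ltnP.
have gi := galois i0 i0; have gj := galois j0 j0; have gij := galois i0 j0.
have di := @DDE i i0; have dj := @DDE j j0.
have := @part_anti i j; have := @part_anti j i; lia.
Qed.

End DoubledDistinct.

End Partition.

(** * The coding as the upper half of the set [B] *)

Lemma foldr_max_ge (a : int) (u : seq int) (x : int) :
  x \in a :: u -> x <= foldr Num.max a u.
Proof.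
elim: u => [|y u IH] in x *; first by rewrite inE => /eqP ->.
rewrite !inE /= le_max => /or3P[/eqP ->|/eqP ->|hx]; rewrite ?lexx //.
  by rewrite IH ?orbT // mem_head.
by rewrite IH ?orbT // inE hx orbT.
Qed.

Lemma foldr_max_mem (a : int) (u : seq int) : foldr Num.max a u \in a :: u.
Proof.
elim: u => [|y u IH] /=; first by rewrite mem_head.
by rewrite maxEle; case: ifP => _; [move: IH; rewrite !inE => /orP[]->|rewrite !inE eqxx]; rewrite ?orbT.
Qed.

Lemma seqmax_ge (u : seq int) (x : int) : x \in u -> x <= seqmax u.
Proof. by move=> hx; apply: foldr_max_ge; rewrite inE hx orbT. Qed.

Lemma seqmax_mem (u : seq int) (x : int) : x \in u -> seqmax u \in u.
Proof.
case: u => // y u _; have := foldr_max_mem y (y :: u).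
by rewrite /seqmax /= !inE orbA orbb.
Qed.

Lemma filter_gt_sorted (c : int) (u : seq int) :
  sorted (fun x y : int => y <= x) u ->
  [seq x <- u | c < x] = take (count (fun x => c < x) u) u.
Proof.
elim: u => //= x u IH hxu; have := path_sorted hxu => /IH {}IH.
case: ifP => hx; first by rewrite IH.
have : all (fun y : int => y <= x) u.
  by apply: order_path_min hxu => a b d /= h1 h2; apply: le_trans h1.
move=> /allP xu.
have -> : [seq y <- u | c < y] = [::].
  by apply/eqP; rewrite -(negbK (_ == _)) -has_filter; apply/hasPn => y /xu; lia.
rewrite add0n (_ : count _ _ = 0%N) //.
by apply/eqP; rewrite -leqn0 leqNgt -has_count; apply/hasPn => y /xu; lia.
Qed.

Section Coding.

Variables (t : nat) (la : seq nat).
Hypotheses (la_part : is_partition la) (la_DD : is_DD la).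
Hypothesis la_core : is_core (2 * t + 2) la.

Let g : nat := (2 * t + 2)%N.

(** Otherwise [x] and [x - g] would define a box with hook length [g]. *)
Lemma maya_core (x : int) : maya la x -> maya la (x - g%:Z).
Proof.
move=> /mayaP[i i0 hx]; apply/negPn/negP => /(mayaPn la_part)[j j0 hy].
have hb : (i, j) \in boxes la.
  by rewrite mem_boxes i0 j0 /=; have := leq_part_conjpart la_part i0 j0; lia.
move/allP: la_core => /(_ _ hb); rewrite -/g (_ : hook la _ = g%:Z) ?dvdzz //.
by rewrite /hook /=; lia.
Qed.

Lemma maya_core_iter (n : nat) (x : int) : maya la x -> maya la (x - n%:Z * g%:Z).
Proof.
elim: n => [|n IH] hx; first by rewrite mul0r subr0.
by have := maya_core (IH hx); rewrite (_ : _ - g%:Z = x - n.+1%:Z * g%:Z) //; lia.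
Qed.

Lemma mem_resvals k (x : int) :
  reflect (exists j : nat, [/\ (0 < j <= size la + g)%N, x = (part la j)%:Z - j%:Z
     & exists q : int, x = q * g%:Z + k%:Z])
    (x \in resvals g la k).
Proof.
apply: (iffP mapP) => [[j]|[j [hj hx [q hq]]]].
  rewrite mem_filter mem_iota => /andP[/dvdzP[q hq] hj] ->.
  by exists j; split=> //; exists q; lia.
exists j => //; rewrite mem_filter mem_iota -hx; apply/andP; split; last by lia.
by apply/dvdzP; exists q; lia.
Qed.

Lemma beta_spec k : (k < g)%N ->
  [/\ maya la (beta g la k - g%:Z), ~~ maya la (beta g la k)
    & exists q : int, beta g la k = q * g%:Z + k%:Z].
Proof.
move=> hk.
(* The last [g] indices lie beyond the length and give the values [- j], which cover every residue;
   [c] picks the right one. *)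
have [y hy ylow] : exists2 y : int, y \in resvals g la k & - (size la + g)%:Z <= y.
  pose c := modz ((size la + g)%:Z + k%:Z) g%:Z.
  have hc := divz_eq ((size la + g)%:Z + k%:Z) g%:Z; rewrite -/c in hc.
  have c0 : 0 <= c by apply: modz_ge0; lia.
  have cg : c < g%:Z by apply: ltz_pmod; lia.
  exists (c - (size la + g)%:Z); last by lia.
  apply/mem_resvals; exists (absz ((size la + g)%:Z - c)%R); split; first by lia.
    by rewrite part_default; lia.
  by exists (- divz ((size la + g)%:Z + k%:Z) g%:Z); lia.
have hmem := seqmax_mem hy; have hmax := @seqmax_ge (resvals g la k).
rewrite /beta; have hyz := hmax _ hy; set z := seqmax _ in hmem hmax hyz *.
have [j [hj hz [q hq]]] := mem_resvals k z hmem.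
split.
- by apply/mayaP; exists j; lia.
- apply/mayaP => -[i i0 hi].
  (* The lower bound on [z] keeps the index of [g + z] within the truncated list, so [g + z] would
     contradict maximality. *)
  have hi' : (0 < i <= size la + g)%N by have := @part_default la i; lia.
  have : g%:Z + z \in resvals g la k.
    by apply/mem_resvals; exists i; split=> //; exists (q + 1); lia.
  by move=> /hmax; lia.
- by exists (q + 1); lia.
Qed.

Definition betas : seq int := [seq beta g la k | k <- iota 0 g].

Lemma betas_uniq : uniq betas.
Proof.
rewrite map_inj_in_uniq ?iota_uniq // => a b; rewrite !mem_iota => ha hb e.
have [_ _ [p hp]] := @beta_spec a ltac:(lia).
have [_ _ [q hq]] := @beta_spec b ltac:(lia).
case: (ltrgtP p q) => hpq; last by rewrite hpq in hp; lia.
- by have : 0 <= (q - p - 1) * g%:Z by [apply: mulr_ge0; lia]; lia.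
- by have : 0 <= (p - q - 1) * g%:Z by [apply: mulr_ge0; lia]; lia.
Qed.

Lemma mem_betas (x : int) : (x \in betas) = maya la (x - g%:Z) && ~~ maya la x.
Proof.
apply/mapP/andP => [[k]|[h1 h2]].
  by rewrite mem_iota => hk ->; have [] := @beta_spec k ltac:(lia).
have c0 : 0 <= modz x g%:Z by apply: modz_ge0; lia.
have cg : modz x g%:Z < g%:Z by apply: ltz_pmod; lia.
exists (absz (modz x g%:Z)); first by rewrite mem_iota; lia.
have [b1 b2 [q hq]] := @beta_spec (absz (modz x g%:Z)) ltac:(lia).
set b := beta _ _ _ in b1 b2 hq *.
have hx := divz_eq x g%:Z; set p := divz _ _ in hx.
(* If [x] and [b] differed, subtracting multiples of [g] from the larger one minus [g] would bring
   the smaller one into [S]. *)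
case: (ltrgtP p q) => hpq; last by rewrite hpq in hx; lia.
- have := @maya_core_iter (absz (q - p - 1)%R) _ b1.
  by rewrite (_ : _ - _ = x) ?(negPf h2) //; lia.
- have := @maya_core_iter (absz (p - q - 1)%R) _ h1.
  by rewrite (_ : _ - _ = b) ?(negPf b2) //; lia.
Qed.

(** The reflection exchanges the two conditions [x - g] in [S] and [x] not in [S]. *)
Lemma betas_reflect (x : int) : x != 0 -> (x \in betas) -> (g%:Z - x \in betas).
Proof.
rewrite !mem_betas => x0 /andP[h1 h2].
have xg : x - g%:Z != 0 by apply: contraTneq h1 => ->; rewrite maya0.
have -> : g%:Z - x - g%:Z = - x by ring.
by rewrite -(opprB x) !maya_opp // h1 h2.
Qed.

Lemma mem_betas0 : 0 \in betas.
Proof.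
rewrite mem_betas add0r maya0 // maya_opp //; last by lia.
rewrite andbT; apply: contra (maya0 la_part la_DD) => h.
by have := maya_core h; rewrite subrr.
Qed.

Lemma mem_betas_half : (t.+1)%:Z \in betas.
Proof.
rewrite mem_betas (_ : _ - g%:Z = - (t.+1)%:Z); last by rewrite /g; lia.
rewrite maya_opp // andbb; apply/negP => h.
by have := maya_core h; rewrite (_ : _ - g%:Z = - (t.+1)%:Z) ?maya_opp ?h //; rewrite /g; lia.
Qed.

(** Of the [2 t + 2] elements of [B], those other than [0] and [t + 1] are exchanged in twos by
    [x |-> g - x], one of each two lying above [t + 1]. *)
Lemma count_betas : count (fun x => (t.+1)%:Z < x) betas = t.
Proof.
pose small (x : int) := (x != 0) && (x < (t.+1)%:Z).
have sym : count (fun x => (t.+1)%:Z < x) betas = count small betas.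
  rewrite -!size_filter -(size_map (fun x => g%:Z - x)).
  apply: perm_size; apply: uniq_perm.
  - by rewrite map_inj_uniq ?filter_uniq ?betas_uniq // => a b; lia.
  - by rewrite filter_uniq ?betas_uniq.
  move=> x; rewrite mem_filter; apply/mapP/idP.
    move=> [y]; rewrite mem_filter => /andP[hy yb] ->.
    rewrite betas_reflect // ?andbT; last by lia.
    have : y != g%:Z.
      apply: contraTneq yb => ->; rewrite mem_betas subrr.
      by rewrite (negPf (maya0 la_part la_DD)).
    by rewrite /small /g in hy *; lia.
  rewrite /small => /andP[/andP[x0 hx] xb]; exists (g%:Z - x); last by lia.
  by rewrite mem_filter betas_reflect // andbT /g; lia.
have c0 : count (pred1 0) betas = 1%N by rewrite count_uniq_mem ?betas_uniq ?mem_betas0.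
have ch : count (pred1 (t.+1)%:Z) betas = 1%N.
  by rewrite count_uniq_mem ?betas_uniq ?mem_betas_half.
have : size betas = g by rewrite size_map size_iota.
have -> : size betas = (count (fun x => ((t.+1)%:Z < x)%R) betas
   + count small betas
   + count (pred1 0%R) betas + count (pred1 (t.+1)%:Z) betas)%N.
  rewrite /small; elim: betas => //= x u ->; case: (eqVneq x 0); case: (eqVneq x (t.+1)%:Z) => /=; lia.
by rewrite -sym c0 ch /g; lia.
Qed.

Definition rcode (i : nat) : int := nth 0 (Vcoding g t la) i.-1 - t%:Z - 1.

Lemma VcodingE : Vcoding g t la =
  [seq x <- sort (fun x y : int => y <= x) betas | (t.+1)%:Z < x].
Proof.
rewrite filter_gt_sorted.
  by rewrite (permP (permEl (perm_sort _ _))) count_betas.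
by apply: sort_sorted => x y /=; exact: le_total.
Qed.

Lemma mem_Vcoding (x : int) : (x \in Vcoding g t la) = ((t.+1)%:Z < x) && (x \in betas).
Proof. by rewrite VcodingE mem_filter mem_sort. Qed.

Lemma size_Vcoding : size (Vcoding g t la) = t.
Proof. by rewrite VcodingE size_filter (permP (permEl (perm_sort _ _))) count_betas. Qed.

Lemma maya_symmetric_core : symmetric_core t (psize la) (maya la) rcode.
Proof.
have hnth i : (1 <= i < t.+1)%N -> nth 0 (Vcoding g t la) i.-1 \in Vcoding g t la.
  by move=> hi; apply: mem_nth; rewrite size_Vcoding; lia.
have mem_rcode x : (t.+1)%:Z < x -> x \in betas ->
    exists2 i, (1 <= i < t.+1)%N & x = (t.+1)%:Z + rcode i.
  move=> hx xb; have xV : x \in Vcoding g t la by rewrite mem_Vcoding hx.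
  exists (index x (Vcoding g t la)).+1.
    by have := index_mem x (Vcoding g t la); rewrite xV size_Vcoding; lia.
  by rewrite /rcode /= nth_index //; lia.
have rcode_mem i : (1 <= i < t.+1)%N ->
    (0 < rcode i) && ((t.+1)%:Z + rcode i \in betas).
  move=> /hnth; rewrite mem_Vcoding /rcode => /andP[h1 h2]; apply/andP; split; first by lia.
  by rewrite (_ : (t.+1)%:Z + _ = nth 0 (Vcoding g t la) i.-1) //; lia.
split.
- by move=> x hx; apply: maya_low => //; have := size_leq_psize la_part; lia.
- by move=> x hx; apply: maya_high.
- by move=> x; apply: maya_opp.
- exact: maya0.
- exact: maya_core.
- by move=> i /rcode_mem/andP[].
- move=> i j i0 hij.
  have ge_tr : transitive (fun x y : int => y <= x).
    by move=> a b c /= h1 h2; apply: le_trans h1.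
  have ge_re : reflexive (fun x y : int => y <= x) by move=> a /=.
  have Vsorted : sorted (fun x y : int => y <= x) (Vcoding g t la).
    rewrite VcodingE; apply: sorted_filter => //.
    by apply: sort_sorted => x y /=; exact: le_total.
  have Vuniq : uniq (Vcoding g t la).
    by rewrite VcodingE filter_uniq ?sort_uniq ?betas_uniq.
  have hi : (i.-1 < size (Vcoding g t la))%N by rewrite size_Vcoding; lia.
  have hj : (j.-1 < size (Vcoding g t la))%N by rewrite size_Vcoding; lia.
  have hne := nth_uniq 0 hi hj Vuniq.
  have hle := @sorted_leq_nth _ _ ge_tr ge_re 0 _ Vsorted i.-1 j.-1 hi hj.
  have {}hle : nth 0 (Vcoding g t la) j.-1 <= nth 0 (Vcoding g t la) i.-1 by apply: hle; lia.
  by rewrite /rcode !ltrD2r lt_neqAle hle eq_sym hne andbT; lia.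
(* Elements of [B] above [t + 1] come from the coding; those below, except [0], are their
   reflections. *)
- move=> x; rewrite -mem_betas !inE mem_cat; apply/idP/idP => [xb|].
    have [//|x0] := eqVneq x 0; have [//|xt] := eqVneq x (t.+1)%:Z => /=.
    case: (ltrP x (t.+1)%:Z) => hx.
      have hgx := betas_reflect x0 xb.
      have [|i hi e] := mem_rcode (g%:Z - x) _ hgx; first by rewrite /g; lia.
      by apply/orP; right; apply/mapP; exists i; rewrite ?mem_index_iota // /g in e *; lia.
    have [|i hi e] := mem_rcode x _ xb; first by lia.
    by apply/orP; left; apply/mapP; exists i; rewrite ?mem_index_iota.
  case/or3P => [/eqP ->|/eqP ->|/orP[]/mapP[i]]; first exact: mem_betas0.
  - exact: mem_betas_half.
  - by rewrite mem_index_iota => /rcode_mem/andP[_ h] ->.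
  rewrite mem_index_iota => /rcode_mem/andP[h0 h] ->.
  have := betas_reflect _ h; rewrite (_ : g%:Z - _ = (t.+1)%:Z - rcode i); last by rewrite /g; lia.
  by apply; lia.
Qed.

End Coding.

(** * The multiset identity and the two formulas *)

Lemma root_values_gt0 (t K : nat) s (r : nat -> int) x :
  symmetric_core t K s r -> x \in root_values t r -> 0 < x.
Proof.
move=> hs; have rp := @sc_pos _ _ _ _ hs; have rd := @sc_decr _ _ _ _ hs.
rewrite !mem_cat => /or3P[/mapP[i]|/allpairsPdep[i [j []]]|/allpairsPdep[i [j []]]];
  rewrite !mem_index_iota.
- by move=> /rp h ->.
- by move=> hi hj ->; have := rd i j; lia.
- by move=> hi hj ->; have := rp i hi; have := rp j; lia.
Qed.

Lemma sum_sqr (n : nat) :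
  6 * (\sum_(1 <= i < n.+1) i%:Z ^+ 2) = n%:Z * (n%:Z + 1) * (2 * n%:Z + 1).
Proof.
elim: n => [|n IH]; first by rewrite big_geq.
rewrite big_nat_recr //= mulrDr IH -natz -natr1 natz; ring.
Qed.

Section Main.

Variables (t : nat) (la : seq nat).
Hypotheses (la_part : is_partition la) (la_DD : is_DD la).
Hypothesis la_core : is_core (2 * t + 2) la.

Let g : nat := (2 * t + 2)%N.
Let r : nat -> int := rcode t la.
Let r0 (i : nat) : int := (t.+1)%:Z - i%:Z.

Let hs : symmetric_core t (psize la) (maya la) r.
Proof. exact: maya_symmetric_core. Qed.

Let hs0 : symmetric_core t (psize la) vacuum r0.
Proof. exact: vacuum_core. Qed.

Lemma eps_cases u : eps u = 1 \/ eps u = -1.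
Proof. by rewrite /eps; case: ifP; [right|left]. Qed.

Lemma hook_neq_core u : u \in boxes la -> hook la u != g%:Z.
Proof.
by move=> hu; move/allP: la_core => /(_ u hu); apply: contraNneq => ->; rewrite dvdzz.
Qed.

Lemma count_hook_pos (L : nat) (m : int) : 0 < m -> (psize la + absz m <= L)%N ->
  (count (fun u => (hook la u == m) && (eps u == 1)) (boxes la))%:Z =
  npairs_pos L (maya la) m.
Proof.
move=> m0 hL; rewrite /npairs_pos -(count_boxes la_part (fun x => m <= 2 * x) m0 hL).
congr Posz; apply: eq_in_count => u hu /=.
by case: eqP => //= <-; rewrite (eps_eq1 la_part).
Qed.

Lemma count_hook_neg (L : nat) (m : int) : 0 < m -> (psize la + absz m <= L)%N ->
  (count (fun u => (hook la u == m) && (eps u != 1)) (boxes la))%:Z =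
  npairs_neg L (maya la) m.
Proof.
move=> m0 hL; rewrite /npairs_neg -(count_boxes la_part (fun x => 2 * x < m) m0 hL).
congr Posz; apply: eq_in_count => u hu /=.
by case: eqP => //= <-; rewrite (eps_eq1 la_part) // -ltNge.
Qed.

Lemma count_hook (L : nat) (m : int) : 0 < m -> (psize la + absz m <= L)%N ->
  (count (fun u => hook la u == m) (boxes la))%:Z = npairs L (maya la) m.
Proof.
move=> m0 hL; rewrite npairsE -count_hook_pos // -count_hook_neg // !count_ind.
by rewrite -big_split; apply: eq_bigr => u _ /=; case: eqP; case: (eps u == 1).
Qed.

(** For [eps = 1] the absolute value is [m] when the hook length is [g + m] or [g - m]; for
    [eps = -1], when it is [m - g]. *)
Lemma count_shifted_hook (L : nat) (m : int) : 0 < m ->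
  (psize la + absz m + g <= L)%N ->
  (count (fun u => `|hook la u - eps u * g%:Z| == m) (boxes la))%:Z =
  npairs_pos L (maya la) (g%:Z + m) +
  (if m < g%:Z then npairs_pos L (maya la) (g%:Z - m)
   else npairs_neg L (maya la) (m - g%:Z)).
Proof.
move=> m0 hL; rewrite -count_hook_pos; [|lia|lia].
case: ltrP => hm.
  rewrite -count_hook_pos; [|lia|lia].
  rewrite !count_ind -big_split big_seq [RHS]big_seq; apply: eq_bigr => u hu /=.
  by have := hook_gt0 la_part hu; case: (eps_cases u) => -> /=; lia.
have [mg|mg] := eqVneq m g%:Z.
  rewrite mg subrr (_ : npairs_neg _ _ _ = 0) ?addr0; last first.
    by rewrite /npairs_neg big1 // => x _; rewrite subr0; case: (maya la x).
  rewrite !count_ind big_seq [RHS]big_seq; apply: eq_bigr => u hu /=.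
  by have := hook_gt0 la_part hu; case: (eps_cases u) => -> /=; lia.
rewrite -count_hook_neg; [|lia|lia].
rewrite !count_ind -big_split big_seq [RHS]big_seq; apply: eq_bigr => u hu /=.
by have := hook_gt0 la_part hu; case: (eps_cases u) => -> /=; lia.
Qed.

Lemma count_hooks_roots (m : int) : 0 < m ->
  (count (fun u => `|hook la u - eps u * g%:Z| == m)%R (boxes la)
     + count_mem m (root_values t r0))%N =
  (count (fun u => hook la u == m) (boxes la) + count_mem m (root_values t r))%N.
Proof.
move=> m0; pose L := (psize la + 2 * absz m + 4 * g)%N.
have hL : (psize la + 2 * absz m + 4 * g <= L)%N by [].
have := net_change_eq hs hs0 m0 hL.
have [_ -> _] := @npairs_vacuum L (g%:Z + m) ltac:(lia).
have [-> _ _] := @npairs_vacuum L m ltac:(lia).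
rewrite [X in _ = _ + X - _ - _](_ : _ = 0); last first.
  by case: ltrP => hmg; [have [] := @npairs_vacuum L (g%:Z - m) ltac:(lia)
                        |have [] := @npairs_vacuum L (m - g%:Z) ltac:(lia)].
rewrite -count_shifted_hook //; last by rewrite /L; lia.
rewrite -count_hook //; last by rewrite /L; lia.
by move=> h; apply/eqP; rewrite -eqz_nat !PoszD; apply/eqP; lra.
Qed.

(** Comparing positive multiplicities suffices: no hook length equals [g], so every listed value is
    positive. *)
Lemma perm_hooks_roots :
  perm_eq ([seq (`|hook la u - eps u * g%:Z| : int) | u <- boxes la]
             ++ root_values t r0)
          ([seq hook la u | u <- boxes la] ++ root_values t r).
Proof.
apply/allP => m hm; apply/eqP; rewrite [LHS]count_cat [RHS]count_cat !(count_map _ _ (boxes la)).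
apply: (@count_hooks_roots m).
move: hm; rewrite mem_cat => /orP[]; rewrite mem_cat => /orP[].
- case/mapP => u hu ->; have := hook_gt0 la_part hu; have := hook_neq_core hu.
  by case: (eps_cases u) => -> /=; lia.
- exact: root_values_gt0 hs0.
- by case/mapP => u hu ->; apply: hook_gt0.
- exact: root_values_gt0 hs.
Qed.

Lemma psize_roots : g%:Z * (psize la)%:Z =
  \sum_(1 <= i < t.+1) r i ^+ 2 - \sum_(1 <= i < t.+1) i%:Z ^+ 2.
Proof.
pose L := (psize la + 2 * g)%N.
rewrite (@psize_maya la la_part L) ?leq_addr // (sum_sqr_root_eq hs hs0) //.
congr (_ - _); rewrite big_nat_rev; apply: eq_big_nat => i hi /=.
by rewrite /r0; congr (_ ^+ 2); lia.
Qed.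

(** The sum of [i ^ 2] divided by [g] is [t (2 t + 1) / 12], where [t = g / 2 - 1] and
    [2 t + 1 = g - 1]. *)
Lemma psize_formula : ((psize la)%:R : rat) =
  (1 / g%:R) * (\sum_(1 <= i < t.+1) (r i ^+ 2)%:~R)
  - ((g%:R / 2 - 1) * (g%:R - 1)) / 12.
Proof.
have := sum_sqr t; have := psize_roots; rewrite -(rmorph_sum (@intmul rat 1)) /=.
move: (\sum_(1 <= i < t.+1) r i ^+ 2) (\sum_(1 <= i < t.+1) i%:Z ^+ 2) => X Y h6 h.
have gE : (g%:R : rat) = 2 * t%:R + 2 by rewrite /g natrD natrM.
have g0 : 2 * t%:R + 2 != 0 :> rat by rewrite -gE pnatr_eq0 /g addn2.
have {}h6 : (2 * t%:R + 2) * (psize la)%:R = X%:~R - Y%:~R :> rat.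
  by rewrite -gE -rmorphB -h6 rmorphM.
have {}h : 6 * Y%:~R = t%:R * (t%:R + 1) * (2 * t%:R + 1) :> rat.
  by have := congr1 (fun z : int => z%:~R : rat) h; rewrite !(rmorphM, rmorphD).
have -> : X%:~R = (2 * t%:R + 2) * (psize la)%:R
    + t%:R * (t%:R + 1) * (2 * t%:R + 1) / 6 :> rat by lra.
by rewrite gE; field.
Qed.

Section Product.

Variables (F : fieldType) (tau : int -> F).
Hypothesis tau_neq0 : forall z, tau z != 0.

(** A factor on the right differs from [1] only for a negative argument [- i], that is, for
    [eps = 1] and hook length [g - i]; [alpha] counts these boxes. *)
Lemma prod_sign_change :
  \prod_(1 <= i < g) (tau (- i%:Z) / tau i%:Z) ^+ alpha g la i =
  \prod_(u <- boxes la)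
     (tau (hook la u - eps u * g%:Z) / tau `|hook la u - eps u * g%:Z|).
Proof.
transitivity (\prod_(1 <= i < g) \prod_(u <- boxes la)
    (if (hook la u == g%:Z - i%:Z) && (eps u == 1)
     then tau (- i%:Z) / tau i%:Z else 1)).
  by apply: eq_bigr => i _; rewrite -big_mkcond big_const_seq iter_mulr_1.
rewrite exchange_big /= big_seq [RHS]big_seq; apply: eq_bigr => u hu.
have h0 := hook_gt0 la_part hu; have hg := hook_neq_core hu.
case: (eps_cases u) => eu; rewrite eu /=; last first.
  have -> : `|hook la u - -1 * g%:Z| = hook la u - -1 * g%:Z by lia.
  by rewrite divff // big1 // => i _; rewrite andbF.
case: (ltrP (hook la u) g%:Z) => hlt; last first.
  have -> : `|hook la u - 1 * g%:Z| = hook la u - 1 * g%:Z by lia.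
  rewrite divff // big_nat big1 // => i hi.
  by have -> : (hook la u == g%:Z - i%:Z) = false by lia.
rewrite -big_mkcond /=.
rewrite (eq_bigl (fun i => i == absz (g%:Z - hook la u)%R)); last by move=> i; lia.
rewrite big_nat1_eq ifT; last by lia.
by congr (tau _ / tau _); lia.
Qed.

Lemma prod_hooks :
  \prod_(u <- boxes la) (tau (hook la u - eps u * g%:Z) / tau (hook la u)) =
  (\prod_(1 <= i < g) (tau (- i%:Z) / tau i%:Z) ^+ alpha g la i)
  * (\prod_(1 <= i < t.+1) (tau (r i) / tau i%:Z))
  * (\prod_(1 <= i < t.+1) \prod_(i.+1 <= j < t.+1)
       ((tau (r i - r j) / tau (j%:Z - i%:Z))
        * (tau (r i + r j) / tau (g%:Z - i%:Z - j%:Z)))).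
Proof.
have nz (I : Type) (u : seq I) (f : I -> int) : \prod_(i <- u) tau (f i) != 0.
  elim/big_ind: _ => [|x y x0 y0|i _]; [exact: oner_neq0| |exact: tau_neq0].
  exact: mulf_neq0.
have : \prod_(x <- [seq (`|hook la u - eps u * g%:Z| : int) | u <- boxes la]
              ++ root_values t r0) tau x =
       \prod_(x <- [seq hook la u | u <- boxes la] ++ root_values t r) tau x.
  exact: perm_big perm_hooks_roots.
have nz0 : \prod_(x <- root_values t r0) tau x != 0 by exact: nz.
rewrite [LHS]big_cat [RHS]big_cat !(@big_map _ _ _ _ _ _ (boxes la)) /=.
move: nz0; rewrite !big_root_values /=.
have -> : \prod_(1 <= i < t.+1) tau (r0 i) = \prod_(1 <= i < t.+1) tau i%:Z.
  rewrite big_nat_rev; apply: eq_big_nat => i hi.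
  by congr tau; rewrite /r0; lia.
(* The root values of the empty partition are the denominators: [r0 i - r0 j = j - i] and
   [r0 i + r0 j = g - i - j]. *)
have -> : \prod_(1 <= i < t.+1) \prod_(i.+1 <= j < t.+1)
    (tau (r0 i - r0 j) * tau (r0 i + r0 j)) =
  \prod_(1 <= i < t.+1) \prod_(i.+1 <= j < t.+1)
    (tau (j%:Z - i%:Z) * tau (g%:Z - i%:Z - j%:Z)).
  apply: eq_bigr => i _; apply: eq_bigr => j _.
  by congr (tau _ * tau _); rewrite /r0 /g; lia.
have -> : \prod_(1 <= i < t.+1) \prod_(i.+1 <= j < t.+1)
       ((tau (r i - r j) / tau (j%:Z - i%:Z))
        * (tau (r i + r j) / tau (g%:Z - i%:Z - j%:Z))) =
  (\prod_(1 <= i < t.+1) \prod_(i.+1 <= j < t.+1) (tau (r i - r j) * tau (r i + r j))) /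
  (\prod_(1 <= i < t.+1) \prod_(i.+1 <= j < t.+1)
    (tau (j%:Z - i%:Z) * tau (g%:Z - i%:Z - j%:Z))).
  rewrite -prodf_div; apply: eq_bigr => i _; rewrite -prodf_div; apply: eq_bigr => j _.
  by rewrite mulf_div.
rewrite prod_sign_change !prodf_div.
have := nz _ (boxes la) (hook la).
have := nz _ (boxes la) (fun u => `|hook la u - eps u * g%:Z|).
move: (\prod_(u <- boxes la) tau `|_|) (\prod_(u <- boxes la) tau (hook la u)).
move: (\prod_(u <- boxes la) _) (\prod_(1 <= i < t.+1) \prod_(_ <= _ < _) (tau (r i - _) * _)).
move: (\prod_(1 <= i < t.+1) \prod_(_ <= _ < _) _) (\prod_(1 <= i < t.+1) tau (r i)).
move: (\prod_(1 <= i < t.+1) _) => R0a R0b Ra N Rb A H A0 H0.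
rewrite mulf_eq0 negb_or => /andP[R0a0 R0b0] e.
rewrite !mulf_div; apply/eqP; rewrite eqr_div ?mulf_neq0 //; apply/eqP.
by rewrite -mulrA e; ring.
Qed.

End Product.

End Main.

Local Close Scope ring_scope.

Theorem theorem3p2 (t : nat) (omega : seq nat) :
  0 < t ->
  is_partition omega -> is_DD omega -> is_core (2 * t + 2) omega ->
  let g := (2 * t + 2)%N in
  let v := Vcoding g t omega in
  let r := fun i : nat => (nth 0%R v i.-1 - t%:Z - 1)%R in
  ((psize omega)%:R : rat)
    = ((1 / g%:R) * (\sum_(1 <= i < t.+1) (r i ^+ 2)%:~R)
       - ((g%:R / 2 - 1) * (g%:R - 1)) / 12)%R
  /\
  (forall (F : fieldType) (tau : int -> F), (forall z, tau z != 0%R) ->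
    (\prod_(s <- boxes omega)
        (tau (hook omega s - eps s * g%:Z) / tau (hook omega s)))%R
    = ((\prod_(1 <= i < g) (tau (- i%:Z) / tau i%:Z) ^+ alpha g omega i)
       * (\prod_(1 <= i < t.+1) (tau (r i) / tau i%:Z))
       * (\prod_(1 <= i < t.+1) \prod_(i.+1 <= j < t.+1)
            ((tau (r i - r j) / tau (j%:Z - i%:Z))
             * (tau (r i + r j) / tau (g%:Z - i%:Z - j%:Z)))))%R).
Proof.
move=> _ hp hd hc g v r.
split; [exact: psize_formula hp hd hc|exact: prod_hooks hp hd hc].
Qed.
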